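(* There exists an absolute constant $C>0$ such that the following holds for all $\alpha\in(0,1)$. Let $\sigma\in S_n$ be a permutation whose conjugacy class $\sigma^{S_n}$ has density $\frac{|\sigma^{S_n}|}{n!}\ge n^{-2\alpha n^{\alpha}}$. Then for every irreducible character $\chi$ of $S_n$ of level $d\le\alpha n^{\alpha}\log n$ we have $$\left|\frac{\chi(\sigma)}{\chi(1)}\right|\le n^{d(\alpha-1)}\left(\frac{C\alpha\log n}{\log(\alpha n^{\alpha}\log n)-\log d}\right)^{d}.$$
   Context: $S_n$ is the symmetric group on $n$ letters, and irreducible characters are the complex irreducible characters $\chi_\lambda$ indexed by partitions $\lambda=(\lambda_1\ge\lambda_2\ge\cdots)$ of $n$. Write $\lambda'$ for the conjugate partition (transposed Young diagram), so $\lambda_1'$ is the number of parts of $\lambda$. The level of $\chi_\lambda$ is $\min(n-\lambda_1,\,n-\lambda_1')$. The logarithm is natural. Conventions for degenerate cases: when $d=0$ the $d$-th power on the right-hand side is $1$; when $d\ge1$ and the denominator $\log(\alpha n^{\alpha}\log n)-\log d$ is $0$, the right-hand side is $+\infty$ (the bound is vacuous). *)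

(* Defs.v *)
From HB Require Import structures.
From mathcomp Require Import all_boot all_order all_algebra all_fingroup.
From mathcomp Require Import mxrepresentation.
From mathcomp Require Import complex.
From mathcomp Require Import all_classical all_reals all_analysis.

Set Implicit Arguments.
Unset Strict Implicit.
Unset Printing Implicit Defensive.

Import Order.TTheory GRing.Theory Num.Theory.

Local Open Scope ring_scope.

Definition is_partition (n : nat) (la : seq nat) : bool :=
  [&& sorted geq la, 0%N \notin la & sumn la == n].

Definition conj_partition (la : seq nat) : seq nat :=
  mkseq (fun j => count (fun r => j < r)%N la) (head 0%N la).

Definition level_of (n : nat) (la : seq nat) : nat :=
  minn (n - head 0%N la) (n - head 0%N (conj_partition la)).

(* The Young diagram of la is filled row by row with 0, 1, ..., n-1: the entry
   k lies in row [reshape_index la k] and in column [reshape_offset la k].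
   Any other filling would give an isomorphic Specht module. *)
Definition row_stabilizer (n : nat) (la : seq nat) : {set 'S_n} :=
  [set s : 'S_n |
    [forall k : 'I_n, reshape_index la (s k) == reshape_index la k]].

Definition column_stabilizer (n : nat) (la : seq nat) : {set 'S_n} :=
  [set s : 'S_n |
    [forall k : 'I_n, reshape_offset la (s k) == reshape_offset la k]].

(* An element of the group algebra F[S_n] is a row vector indexed by S_n, as in
   [regular_repr].  Permutations multiply from left to right here, (p * q) k =
   q (p k), and the regular representation acts on the right: the right ideal
   generated below is the left ideal F[S_n] b_la a_la for the composition of
   functions, where a_la sums the row stabilizer and b_la is the signed sum of
   the column stabilizer.  So la = (n) gives the trivial character. *)
Definition young_symmetrizer (F : fieldType) (n : nat) (la : seq nat) :
    'rV[F]_#|[set: 'S_n]%G| :=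
  \sum_(p in row_stabilizer n la) \sum_(q in column_stabilizer n la)
    (-1) ^+ q *: delta_mx 0 (gring_index [set: 'S_n]%G (p * q)%g).

Definition specht_repr (F : fieldType) (n : nat) (la : seq nat) :=
  submod_repr (cyclic_mx_module (regular_repr F [set: 'S_n]%G)
                                (young_symmetrizer F n la)).

Definition repr_char (F : fieldType) (n m : nat)
    (rG : mx_representation F [set: 'S_n]%G m) (s : 'S_n) : F :=
  \tr (rG s).

Definition irreducible_char (F : fieldType) (n : nat) (chi : 'S_n -> F) : Prop :=
  exists m (rG : mx_representation F [set: 'S_n]%G m),
    mx_irreducible rG /\ chi =1 repr_char rG.

(* chi has level d: chi is the character chi_la for a partition la of n, and d
   is computed from la. *)
Definition has_level (F : fieldType) (n : nat) (chi : 'S_n -> F) (d : nat) : Prop :=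
  exists la : seq nat,
    [/\ is_partition n la, chi =1 repr_char (specht_repr F n la)
      & d = level_of n la].

Definition class_density (R : realType) (n : nat) (s : 'S_n) : R :=
  #|(s ^: [set: 'S_n])%g|%:R / (n`!)%:R.

(* Extended-real valued: for d = 0 the d-th power is 1, and for d >= 1 with
   vanishing denominator the bound is +oo. *)
Definition char_bound (R : realType) (C alpha : R) (n d : nat) : \bar R :=
  let num := C * alpha * ln n%:R in
  let den := ln (alpha * n%:R `^ alpha * ln n%:R) - ln d%:R in
  if (d != 0)%N && (den == 0) then +oo%E
  else (n%:R `^ (d%:R * (alpha - 1)) * (num / den) ^+ d)%:E.

(* Main.v *)
Require Import Defs.
From HB Require Import structures.
From mathcomp Require Import all_boot all_order all_algebra all_fingroup.
From mathcomp Require Import mxrepresentation.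
From mathcomp Require Import zify ring lra.

(** Let [rho] be the ratio of [chi] at [sigma] and at 1, and let [d] be the level. Class sums act
    by scalars on irreducible representations, so the average of the conjugates of [sigma] acts by
    [rho] on some nonzero vector of the Specht module ([shared_eigenvector]). Coordinates make of
    this vector a function on permutations. If [S] is the first row, or, after a twist by the
    sign, the first column, whichever is longer, then the complement of [S] has [d] points and the
    function is pure on [S]: it depends only on the [d] images of these points, and it has sum
    zero in each of them ([specht_pure_eigenfunction]).

    Evaluate the eigenvalue equation where the function is largest. A random conjugate of [sigma]
    carries some [t] of the [d] points out of their set, to uniformly random places. Sum zero
    allows us to bring these back one by one, each time with a gain of a factor about [t / n];
    in total the contribution is at most the inverse of the binomial coefficient [C(n - d, t)]
    ([biinvariant_decay]). So [rho] is at most the average over all sets [A] of [d] points of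
    [1 / C(n - d, t)], where [t] is the number of points of [A] not in [sigma A]
    ([pure_ratio_bound]).

    The average has denominator [C(n, d)], which is about [(n / d) ^ d], and its numerator is a
    weighted count of sets. Such a set is a union of whole cycles of [sigma] and of [t] arcs of
    cycles. The arcs cost only [C ^ d] ([exit_sum_le_invariant]). The number of invariant sets of
    [d] points is at most [y ^ d * exp (f / y + c / y ^ 2)] for every [y >= 2], where [f] is the
    number of fixed points and [c] that of longer cycles ([exit_count_le]). Put
    [D = alpha * n ^ alpha * ln n]. As the centralizer of [sigma] has order at most
    [exp (2 * D)], [f!] and [2 ^ c] are at most [exp (2 * D)]. Hence [y] can be taken
    to be a constant times [(D / d) / ln (D / d)], which makes [rho] at most
    [(C * d * y / n) ^ d], up to a change of [C] the bound that was to be proved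
    ([ratio_bound]). *)

Set Implicit Arguments.
Unset Strict Implicit.
Unset Printing Implicit Defensive.

Import Order.TTheory GRing.Theory Num.Theory.

Local Open Scope ring_scope.

(** * Eigenvalues of class averages on pure functions *)

Section Averaging.
Variables (K : numFieldType) (T : finType).
Implicit Types (S A : {set T}) (g h s t : {perm T}).

Definition crossings S h := #|[set k in ~: S | h k \in S]|.

(** The functions that come from a Specht module whose first row (or, up to a sign, first column)
    is [S]: [F g] depends only on the tuple of values of [g] off [S], and the sum over all the
    values that one entry of this tuple can take, the other entries being fixed, vanishes (the
    transpositions run through these values). *)
Definition pure_on S (F : {perm T} -> K) : Prop :=
  (forall s g, perm_on S s -> F (s * g)%g = F g) /\
  (forall k g, k \notin S -> \sum_(i in k |: S) F (tperm i k * g)%g = 0).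

(** As [h] is a bijection, as many points enter [S] as leave it. *)
Lemma crossingsE S h : #|[set i in S | h i \notin S]| = crossings S h.
Proof.
have e1 : #|[set i | h i \in S]| = #|S|.
  rewrite -(card_imset S (@perm_inj _ h^-1)); apply: eq_card => x.
  rewrite inE; apply/idP/imsetP => [hx|[y yS ->]]; last by rewrite permKV.
  by exists (h x) => //; rewrite permK.
have := cardsID S [set i | h i \in S]; rewrite e1 => e2.
have := cardsID [set i | h i \in S] S; rewrite -{}e2 setIC => /addnI.
rewrite /crossings => e3; apply: etrans (etrans e3 _); apply: eq_card => x.
  by rewrite !inE andbC.
by rewrite !inE.
Qed.

Lemma crossings_tperm S h k i : k \notin S -> h k \in S -> i \in S -> h i \notin S ->
  crossings S h = (crossings S (tperm i k * h)%g).+1.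
Proof.
move=> kS hk iS hi; rewrite /crossings (cardsD1 k) !inE kS hk add1n; congr _.+1.
apply: eq_card => x; rewrite !inE permM.
have [->|xk] := eqVneq x k; first by rewrite tpermR (negbTE hi) andbF.
case: (boolP (x \in S)) => //= xS; rewrite tpermD //; last by rewrite eq_sym.
by apply: contraNneq xS => <-.
Qed.

(** A function that is pure on [S] and also invariant on the right sees only which points off
    [S] cross into [S]. If [k] is such a point, the vanishing sum at [k] consists of
    [#|S| - t] equal terms [G h] and of [t + 1] terms with one crossing less, where [t + 1] is
    the number of crossings of [h]; so each crossing costs a factor
    [(t + 1) / (#|S| - t)], and the product of these factors is an inverse binomial
    coefficient. *)
Lemma biinvariant_decay S (G : {perm T} -> K) (M : K) :
    pure_on S G -> (forall s g, perm_on S s -> G (g * s)%g = G g) ->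
    (forall g, `|G g| <= M) ->
  forall h, `|G h| * 'C(#|S|, crossings S h)%:R <= M.
Proof.
move=> [_ Gsum] Gr GM h; move: {2}(crossings S h) (erefl (crossings S h)) => t.
elim: t h => [|t IHt] h ht; rewrite ht; first by rewrite bin0 mulr1.
have [k] : exists k, k \in [set k in ~: S | h k \in S].
  by apply/set0Pn; rewrite -card_gt0 -/(crossings S h) ht.
rewrite !inE => /andP[kS hk].
have := Gsum k h kS; rewrite big_setU1 //= tperm1 mul1g.
rewrite (bigID (fun i => h i \in S)) /=.
have -> : \sum_(i in S | h i \in S) G (tperm i k * h)%g
    = G h *+ #|[set i in S | h i \in S]|.
  rewrite -sumr_const; apply: eq_big => [i|i /andP[iS hi]]; first by rewrite !inE.
  (* h maps i and k into S, so the swap of their images is absorbed on the right *)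
  rewrite conjgC tpermJ Gr //.
  by apply/subsetP=> x; rewrite inE; case: tpermP => [->|->|]; rewrite ?eqxx.
set B := \sum_(i in S | _) _ => /eqP; rewrite addrA addr_eq0 => /eqP eB.
have cardS : #|S| = (#|[set i in S | h i \in S]| + t.+1)%N.
  rewrite -ht -crossingsE -(cardsID [set i | h i \in S] S); congr (_ + _)%N.
    by apply: eq_card => x; rewrite !inE.
  by apply: eq_card => x; rewrite !inE andbC.
have bB : `|B| * 'C(#|S|, t)%:R <= M *+ t.+1.
  have -> : M *+ t.+1 = \sum_(i in S | h i \notin S) M.
    rewrite -ht -crossingsE -sumr_const.
    by apply: eq_bigl => i; rewrite !inE.
  apply: le_trans (ler_wpM2r (ler0n _ _) (ler_norm_sum _ _ _)) _.
  rewrite mulr_suml; apply: ler_sum => i /andP[iS hi].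
  have := crossings_tperm kS hk iS hi; rewrite ht => -[] et.
  by have := IHt _ (esym et); rewrite -et.
have eG : `|G h| * (#|S| - t)%:R = `|B|.
  rewrite -[RHS]normrN -eB -mulrS normrMn mulr_natr cardS addnS subSn ?leq_addl //.
  by rewrite addnK.
rewrite -(ler_pM2r (ltr0Sn K t)) -mulrA -natrM [(_ * t.+1)%N]mulnC mul_bin_left.
by rewrite natrM mulrA eG [leRHS]mulr_natr.
Qed.

(** The eigenvalue equation, read at a point where [`|F|] is maximal, expresses [r] as a sum of
    ratios of modulus at most 1; grouping the conjugators by the cosets of the permutations
    supported on [S] replaces [F] by a right invariant average, to which the decay applies. *)
Lemma pure_eigenvalue_bound S (F : {perm T} -> K) (r : K) (s : {perm T}) (g0 : {perm T}) :
    pure_on S F -> F g0 != 0 ->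
    (forall g, \sum_t F (g * s ^ t)%g = r * F g) ->
  `|r| <= \sum_t ('C(#|S|, crossings S (s ^ t)%g)%:R)^-1.
Proof.
move=> pF F0 eF.
have [g1 _ g1max] := @real_arg_maxP K _ g0 predT (fun g => `|F g|) isT
  (fun i _ => normr_real (F i)).
have M0 : 0 < `|F g1| by apply: lt_le_trans (g1max g0 isT); rewrite normr_gt0.
move: g1 g1max M0 => g1 g1max M0; set M := `|F g1| in g1max M0.
(* translated on the right so that the maximum sits at the identity *)
pose H g := F (g * g1)%g.
have pH : pure_on S H.
  case: pF => p1 p2; split=> [u g pu|k g kS]; rewrite /H; first by rewrite -mulgA (p1 u).
  by rewrite -[RHS](p2 k (g * g1)%g kS); apply: eq_bigr => i _; rewrite mulgA.
have HM g : `|H g| <= M by apply: g1max.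
have eH : \sum_t H (s ^ t)%g = r * H 1%g.
  rewrite /H mul1g -eF (reindex_inj (mulIg g1^-1%g)) /=; apply: eq_bigr => t _.
  by rewrite conjgM -conjgCV.
pose P := [set u | perm_on S u].
have P0 : (0 : K) < #|P|%:R.
  by rewrite ltr0n card_gt0; apply/set0Pn; exists 1%g; rewrite inE perm_on1.
pose G g := (\sum_(u in P) H (g * u)%g) / #|P|%:R.
have pG : pure_on S G.
  case: pH => p1 p2; split=> [u g pu|k g kS].
    by congr (_ / _); apply: eq_bigr => v _; rewrite -mulgA (p1 u).
  rewrite -mulr_suml exchange_big /= big1 ?mul0r // => u _.
  by rewrite -[RHS](p2 k (g * u)%g kS); apply: eq_bigr => i _; rewrite mulgA.
have Gr u g : perm_on S u -> G (g * u)%g = G g.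
  move=> pu; congr (_ / _); rewrite [RHS](reindex_inj (mulgI u)) /=.
  apply: eq_big => [v|v _]; last by rewrite mulgA.
  rewrite !inE; apply/idP/idP => pv; first exact: perm_onM.
  by rewrite -(mulKg u v) perm_onM // perm_onV.
have GM g : `|G g| <= M.
  rewrite normrM normfV normr_nat ler_pdivrMr // mulrC mulr_natl -sumr_const.
  by apply: le_trans (ler_norm_sum _ _ _) _; apply: ler_sum.
have eG : \sum_t G (s ^ t)%g = r * H 1%g.
  rewrite -mulr_suml exchange_big /=; apply: (mulIf (lt0r_neq0 P0)).
  rewrite mulfVK ?lt0r_neq0 // mulr_natr -sumr_const; apply: eq_bigr => u.
  rewrite inE => pu; rewrite -eH [RHS](reindex_inj (mulIg u)) /=.
  apply: eq_bigr => t _; rewrite conjgM [((s ^ t) ^ u)%g]conjgE (proj1 pH u^-1%g) //.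
  by apply: perm_onV.
rewrite -(ler_pM2r M0) -[M]/`|F g1| -[g1 in leLHS]mul1g -[F _]/(H 1%g) -normrM -eG.
apply: le_trans (ler_norm_sum _ _ _) _; rewrite mulr_suml; apply: ler_sum => t _.
rewrite mulrC ler_pdivlMr; first exact: biinvariant_decay.
rewrite ltr0n bin_gt0 -crossingsE.
by apply: subset_leq_card; apply/subsetP=> x; rewrite inE => /andP[].
Qed.
End Averaging.

(** * Pure functions from symmetrizers *)

Section Pure.
Variables (K : numFieldType) (T : finType).
Implicit Types (S : {set T}) (g h p q : {perm T}) (A B : {group {perm T}}).

Lemma perm_onJ S p h : perm_on (p @: S) (h ^ p)%g = perm_on S h.
Proof.
apply/subsetP/subsetP => H x hx.
  rewrite -(mem_imset S x (@perm_inj _ p)); apply: H.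
  by rewrite inE permJ (inj_eq perm_inj).
have : (p^-1)%g x \in S.
  apply: H; rewrite inE; apply: contraNneq hx => e; apply/eqP.
  by rewrite -[x in LHS](permKV p) permJ e permKV.
by move=> xS; apply/imsetP; exists ((p^-1)%g x); rewrite ?permKV.
Qed.

(** The transpositions [tperm i k] represent the cosets of the permutations supported on [S]
    in those supported on [k |: S]. *)
Lemma sum_perm_on_coset S k (F : {perm T} -> K) : k \notin S ->
  (forall s g, perm_on S s -> F (s * g)%g = F g) -> forall g,
  \sum_(h | perm_on (k |: S) h) F (h * g)%g
    = #|perm_on S|%:R * \sum_(i in k |: S) F (tperm i k * g)%g.
Proof.
move=> kS inv g; rewrite mulr_sumr.
rewrite (partition_big (fun h : {perm T} => h k) [in k |: S]) /=; last first.
  by move=> h hS; rewrite (perm_closed _ hS) !inE eqxx.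
apply: eq_bigr => i iS; rewrite (reindex_inj (mulIg (tperm i k))) /=.
have cond s : (perm_on (k |: S) (s * tperm i k)%g && ((s * tperm i k)%g k == i))
    = perm_on S s.
  have tS : perm_on (k |: S) (tperm i k).
    apply/subsetP=> x; rewrite inE => tx; move: tx iS.
    by case: tpermP => [->|->|]; rewrite ?eqxx // !inE eqxx.
  apply/andP/idP => [[sS] |sS].
    rewrite permM (canF_eq (tpermK i k)) tpermL => /eqP sk.
    have {}sS : perm_on (k |: S) s.
      by rewrite -(mulgK (tperm i k) s) tpermV perm_onM.
    apply/subsetP=> x sx; move: (subsetP sS x sx); rewrite !inE => /orP[/eqP xk|//].
    by move: sx; rewrite inE xk sk eqxx.
  split; last by rewrite permM (out_perm sS kS) tpermR.
  apply: perm_onM => //; apply: subset_trans sS _; exact: subsetUr.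
rewrite mulr_natl -sumr_const; apply: eq_big => [s|s]; first exact: cond.
by rewrite cond => sS; rewrite -mulgA (inv s).
Qed.

(** The product in the group algebra of the sum of [A], the signed sum of [B], and [phi]: the
    general element of the right ideal generated by a Young symmetrizer when [A] and [B] are the
    row and the column stabilizer. *)
Definition antisymmetrized A B (phi : {perm T} -> K) g : K :=
  \sum_(p in A) \sum_(q in B) (-1) ^+ (q : bool) * phi ((p * q)^-1 * g)%g.

Lemma antisymmetrized_invl A B phi p g :
  p \in A -> antisymmetrized A B phi (p * g)%g = antisymmetrized A B phi g.
Proof.
move=> pA; rewrite /antisymmetrized [LHS](reindex_inj (mulgI p)) /=.
apply: eq_big => [r|r _]; first by rewrite groupMl.
by apply: eq_bigr => q _; congr (_ * phi _); rewrite !invMg -!mulgA mulKg.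
Qed.

(** The sum over the permutations supported on [k |: S] can be moved past [p] at the price of
    replacing [k] by [p k], which is again off [S]. Some transposition of [B] is supported on
    [p k |: S]; it leaves this sum unchanged but reverses the sign of the signed sum of [B]. *)
Lemma antisymmetrized_pure A B S phi :
    (forall p, p \in A -> p @: S = S) ->
    (forall s, perm_on S s -> s \in A) ->
    (forall k, k \notin S -> exists2 i, i \in S & tperm i k \in B) ->
  pure_on S (antisymmetrized A B phi).
Proof.
move=> AS SA SB; set F := antisymmetrized A B phi.
have inv s g : perm_on S s -> F (s * g)%g = F g.
  by move=> /SA; apply: antisymmetrized_invl.
split=> // k g kS.
have nz : #|perm_on S|%:R != 0 :> K by rewrite card_perm pnatr_eq0 -lt0n fact_gt0.
apply: (mulfI nz); rewrite mulr0 -sum_perm_on_coset //.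
rewrite exchange_big /= big1 // => p pA.
pose k' := p k; have k'S : k' \notin S.
  by rewrite -(AS p pA) mem_imset //; apply: perm_inj.
have [i iS tB] := SB k' k'S; set t := tperm i k' in tB.
have tH : perm_on (k' |: S) t.
  apply/subsetP=> x; rewrite inE /t; case: tpermP => [->|->|]; rewrite ?eqxx //.
    by rewrite !inE iS orbT.
  by rewrite !inE eqxx.
rewrite exchange_big /=.
pose X := \sum_(q in B) \sum_(h | perm_on (k' |: S) h)
   (-1) ^+ (q : bool) * phi (q^-1 * (h * (p^-1 * g)))%g.
apply: (@etrans _ _ X).
  apply: eq_bigr => q qB; rewrite [RHS](reindex_inj (conjg_inj p)) /=.
  apply: eq_big => [h|h _].
    by rewrite -(perm_onJ _ p) imsetU1 AS.
  by rewrite conjgE invMg !mulgA mulgK.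
(* translation by t in both variables leaves the argument of phi alone and flips the sign *)
have XN : X = - X.
  rewrite {1}/X (reindex_inj (mulgI t)) /= -sumrN.
  apply: eq_big => [q|q _]; first by rewrite groupMl.
  rewrite (reindex_inj (mulgI t)) /= -sumrN.
  apply: eq_big => [h|h _].
    apply/idP/idP => hS; last exact: perm_onM.
    by rewrite -(mulKg t h) perm_onM // perm_onV.
  rewrite odd_permM odd_tperm (contraNneq _ k'S) => [|<-//].
  rewrite addTb signrN mulNr; congr (- (_ * phi _)).
  by rewrite invMg -!mulgA mulKg.
have : X *+ 2 == 0 by rewrite mulr2n {1}XN addNr.
by rewrite mulrn_eq0 => /eqP.
Qed.

Lemma antisymmetrized_eigen A B phi r s :
  (forall g, \sum_t phi (g * s ^ t)%g = r * phi g) ->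
  forall g, \sum_t antisymmetrized A B phi (g * s ^ t)%g = r * antisymmetrized A B phi g.
Proof.
move=> ephi g; rewrite exchange_big mulr_sumr; apply: eq_bigr => p _ /=.
rewrite exchange_big mulr_sumr; apply: eq_bigr => q _ /=.
rewrite mulrCA -ephi mulr_sumr; apply: eq_bigr => t _.
by rewrite mulgA.
Qed.

Definition sign_twist (phi : {perm T} -> K) g := (-1) ^+ (g : bool) * phi g.

Lemma sign_twist_eigen phi r s :
  (forall g, \sum_t phi (g * s ^ t)%g = r * phi g) ->
  forall g, \sum_t sign_twist phi (g * s ^ t)%g = (-1) ^+ (s : bool) * r * sign_twist phi g.
Proof.
move=> ephi g; rewrite /sign_twist mulrACA -ephi mulr_sumr; apply: eq_bigr => t _.
by rewrite odd_permM odd_permJ signr_addb [X in X * _]mulrC.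
Qed.

Lemma antisymmetrized_twist A B phi g :
    (forall p h, p \in B -> phi (p * h)%g = phi h) ->
  antisymmetrized A B (sign_twist phi) g
    = (-1) ^+ (g : bool) * (#|B|%:R * \sum_(q in A) (-1) ^+ (q : bool) * phi (q^-1 * g)%g).
Proof.
move=> inv; rewrite mulr_sumr mulr_sumr; apply: eq_bigr => q _.
rewrite mulrCA mulr_natl -sumr_const; apply: eq_bigr => p pB.
rewrite /sign_twist invMg -mulgA inv ?groupV // !odd_permM !odd_permV.
rewrite mulrA [RHS]mulrA; congr (_ * _).
by case: (odd_perm p); case: (odd_perm q); case: (odd_perm g); rewrite /= ?expr0 ?expr1; ring.
Qed.

End Pure.

(** In the group algebra with its Hermitian form for which the group elements are orthonormal,
    the sum [a] of [A] and the signed sum [b] of [B] are self-adjoint, and [a * a] is a positive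
    multiple of [a]. So if [b * (a * b * w) = 0] then the norm of [a * b * w] is
    zero. This passes from the vectors with symmetrizer [a * b] to those with symmetrizer
    [b * a], whose sign twist is the symmetrizer of the transposed diagram. *)
Lemma antisymmetrized_twist_neq0 (K : numClosedFieldType) (T : finType)
    (A B : {group {perm T}}) (a : {perm T} -> K) g0 :
  antisymmetrized A B a g0 != 0 ->
  exists g, antisymmetrized B A (sign_twist (antisymmetrized A B a)) g != 0.
Proof.
set f := antisymmetrized A B a => fg0.
have inv p h : p \in A -> f (p * h)%g = f h by apply: antisymmetrized_invl.
case: (pickP (fun g => antisymmetrized B A (sign_twist f) g != 0)) => [g ?|z].
  by exists g.
have {}z g : \sum_(q in B) (-1) ^+ (q : bool) * f (q * g)%g = 0.
  have /negbFE/eqP := z g; rewrite antisymmetrized_twist // => /eqP.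
  rewrite mulf_eq0 signr_eq0 mulf_eq0 pnatr_eq0 eqn0Ngt cardG_gt0 /= => /eqP e.
  rewrite -[RHS]e [LHS](reindex_inj invg_inj) /=.
  by apply: eq_big => [q|q _]; rewrite ?groupV // odd_permV.
have : \sum_g `|f g| ^+ 2 == 0.
  under eq_bigr do rewrite normCK {2}/f /antisymmetrized rmorph_sum mulr_sumr.
  rewrite exchange_big big1 //= => p pA.
  under eq_bigr do rewrite rmorph_sum mulr_sumr.
  rewrite exchange_big /=.
  have e q g : q \in B -> f g * ((-1) ^+ (q : bool) * a ((p * q)^-1 * g)%g)^* =
     (a ((p * q)^-1 * g)%g)^* * ((-1) ^+ (q : bool) * f g).
    by move=> _; rewrite rmorphM rmorph_sign mulrA mulrC [f g * _]mulrC.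
  rewrite (eq_bigr (fun q : {perm T} =>
    \sum_g (a g)^* * ((-1) ^+ (q : bool) * f (q * g)%g))) => [|q qB].
    by rewrite exchange_big big1 //= => g _; rewrite -mulr_sumr z mulr0.
  rewrite (reindex_inj (mulgI (p * q)%g)) /=; apply: eq_bigr => g _.
  by rewrite e // mulKg -mulgA inv.
rewrite psumr_eq0 => [/allP/(_ g0)|g _]; last by rewrite exprn_ge0.
by rewrite mem_index_enum expf_eq0 /= normr_eq0 (negbTE fg0) => /(_ isT).
Qed.

(** * Class operators of representations with equal characters *)

Section Eigen.
Variables (F : numClosedFieldType) (gT : finGroupType) (G : {group gT}).

(** The action of [#|'C_G[x]|] times the class sum of [x]. *)
Definition class_op m (rG : mx_representation F G m) x :=
  \sum_(t in G) rG (x ^ t)%g.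

Lemma class_op_cent m (rG : mx_representation F G m) x : x \in G ->
  centgmx rG (class_op rG x).
Proof.
move=> xG; apply/centgmxP=> y yG; rewrite mulmx_suml mulmx_sumr.
rewrite [RHS](reindex_inj (mulIg y)) /=.
apply: eq_big => [t|t]; rewrite ?groupMr // => tG.
by rewrite -!repr_mxM ?groupJ ?groupM // conjgM -conjgC.
Qed.

Lemma class_op_scalar m (rG : mx_representation F G m) x : x \in G ->
  mx_irreducible rG -> exists a, class_op rG x = a%:M.
Proof.
move=> xG irr; have m0 : (0 < m)%N by case/mx_irrP: irr.
have [a ra] : exists a, root (char_poly (class_op rG x)) a.
  by apply/closed_rootP; rewrite size_char_poly; case: m m0 {irr rG}.
exists a; apply/eqP; rewrite -subr_eq0; apply/negPn/negP => nz.
have /(mx_Schur irr)/(_ nz) : centgmx rG (class_op rG x - a%:M).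
  apply/centgmxP=> y yG; rewrite mulmxBl mulmxBr scalar_mxC.
  by rewrite (centgmxP (class_op_cent rG xG)).
move=> u; have /eigenvalueP[v] : eigenvalue (class_op rG x) a.
  by rewrite eigenvalue_root_char.
move=> ev /eqP v0; apply: v0; rewrite -[v](mulmxK u) mulmxBr ev.
by rewrite mul_mx_scalar subrr mul0mx.
Qed.

(** The coefficients do not depend on the representation, so traces of powers of the class
    operator are determined by the character. *)
Lemma class_op_expr x k : x \in G ->
  exists c : gT -> F, forall m (rG : mx_representation F G m),
  iter k (mulmx (class_op rG x)) 1%:M = \sum_(g in G) c g *: rG g.
Proof.
move=> xG; elim: k => [|k [c IH]].
  exists (fun g => (g == 1%g)%:R) => m rG /=.
  rewrite (bigD1 1%g) //= eqxx scale1r repr_mx1 big1 ?addr0 // => g /andP[_ /negbTE->].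
  by rewrite scale0r.
exists (fun g => \sum_(t in G) c ((x ^ t)^-1 * g)%g) => m rG.
rewrite iterS IH mulmx_suml.
under [RHS]eq_bigr do rewrite scaler_suml.
rewrite [RHS]exchange_big /=; apply: eq_bigr => t tG.
rewrite mulmx_sumr [RHS](reindex_inj (mulgI (x ^ t)%g)) /=.
apply: eq_big => [g|g gG]; first by rewrite groupMl ?groupJ.
by rewrite mulKg [rG (_ * g)%g]repr_mxM ?groupJ // scalemxAr.
Qed.

(** On the irreducible [rG] the class operator is a scalar [a], so on [rH] every polynomial [p]
    in it has trace [m * p.[a]]. For the characteristic polynomial on [rH] this trace is zero,
    whence [a] is an eigenvalue on [rH] too. This replaces an isomorphism between the two
    representations. *)
Lemma shared_eigenvector m m' (rG : mx_representation F G m)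
    (rH : mx_representation F G m') x :
    x \in G -> mx_irreducible rG ->
    (forall g, g \in G -> \tr (rH g) = \tr (rG g)) ->
  exists2 v : 'rV_m', v != 0 &
    v *m class_op rH x = (#|G|%:R * (\tr (rG x) / \tr (rG 1%g))) *: v.
Proof.
move=> xG irr eqtr.
have m0 : (0 < m)%N by case/mx_irrP: irr.
have [a ea] := class_op_scalar xG irr.
have tr1 : \tr (rG 1%g) = m%:R by rewrite repr_mx1 mxtrace1.
have em : m' = m.
  by apply/eqP; rewrite -(eqr_nat F) -tr1 -eqtr // repr_mx1 mxtrace1 eqxx.
subst m'.
have mn0 : m%:R != 0 :> F by rewrite pnatr_eq0 -lt0n.
have -> : #|G|%:R * (\tr (rG x) / \tr (rG 1%g)) = a.
  rewrite tr1 mulrA; apply: (mulIf mn0); rewrite mulfVK //.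
  have := congr1 (fun M => \tr M) ea; rewrite mxtrace_scalar mulr_natr => <-.
  rewrite raddf_sum /= -sum1_card natr_sum mulr_suml; apply: eq_bigr => t tG.
  rewrite mul1r conjgE !repr_mxM ?groupM ?groupV // mxtrace_mulC -mulmxA.
  by rewrite -repr_mxM ?groupV // mulgV repr_mx1 mulmx1.
case: m m0 rG irr rH eqtr ea mn0 {tr1} => // m _ rG irr rH eqtr ea mn0.
have trX k : \tr (class_op rH x ^+ k) = m.+1%:R * a ^+ k.
  have powE (A : 'M[F]_m.+1) : iter k (mulmx A) 1%:M = A ^+ k.
    by elim: k => [|k IH]; rewrite ?expr0 // iterS IH exprS.
  have [c ec] := class_op_expr k xG.
  have -> : \tr (class_op rH x ^+ k) = \tr (class_op rG x ^+ k).
    rewrite -!powE !ec !raddf_sum; apply: eq_bigr => g gG.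
    by rewrite /= !mxtraceZ eqtr.
  by rewrite ea -rmorphXn /= mxtrace_scalar mulr_natl.
have trp p : \tr (horner_mx (class_op rH x) p) = m.+1%:R * p.[a].
  rewrite -[p]coefK poly_def raddf_sum horner_sum mulr_sumr raddf_sum /=.
  apply: eq_bigr => k _; rewrite linearZ /= rmorphXn /= horner_mx_X mxtraceZ trX.
  by rewrite hornerZ hornerXn mulrCA.
have := trp (char_poly (class_op rH x)).
rewrite Cayley_Hamilton mxtrace0 => /esym/eqP; rewrite mulf_eq0 (negbTE mn0) /=.
rewrite -/(root _ a) -eigenvalue_root_char => /eigenvalueP[v ev v0].
by exists v.
Qed.
End Eigen.

(** * Specht modules and their eigenfunctions *)

Section FibreStabilizer.
Variables (T : finType) (X : eqType) (f : T -> X).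

(** For the row index, or the column index, of the cells of a diagram this is the row, or the
    column, stabilizer, by definition. *)
Definition fibre_stabilizer : {set {perm T}} :=
  [set s : {perm T} | [forall k, f (s k) == f k]].

Lemma fibre_stabilizerP (s : {perm T}) :
  reflect (forall k, f (s k) = f k) (s \in fibre_stabilizer).
Proof. by rewrite inE; apply: forallPP => k; apply: eqP. Qed.

Fact fibre_stabilizer_group_set : group_set fibre_stabilizer.
Proof.
apply/group_setP; split=> [|s t /fibre_stabilizerP fs /fibre_stabilizerP ft].
  by apply/fibre_stabilizerP => k; rewrite perm1.
by apply/fibre_stabilizerP => k; rewrite permM ft.
Qed.
Canonical fibre_stabilizer_group := Group fibre_stabilizer_group_set.

Lemma fibre_stabilizer_imset (x : X) p :
  p \in fibre_stabilizer -> p @: [set k | f k == x] = [set k | f k == x].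
Proof.
move=> /fibre_stabilizerP fp; apply/eqP.
rewrite eqEcard card_imset ?leqnn ?andbT; last exact: perm_inj.
by apply/subsetP=> _ /imsetP[k + ->]; rewrite !inE fp.
Qed.

Lemma perm_on_fibre_stabilizer (x : X) s :
  perm_on [set k | f k == x] s -> s \in fibre_stabilizer.
Proof.
move=> ps; apply/fibre_stabilizerP => k.
case: (boolP (k \in [set k | f k == x])) => kx; last by rewrite (out_perm ps kx).
move: (kx); rewrite -(perm_closed _ ps) => skx; move: kx skx.
by rewrite !inE => /eqP-> /eqP->.
Qed.

Lemma tperm_fibre_stabilizer i k : f i = f k -> tperm i k \in fibre_stabilizer.
Proof. by move=> e; apply/fibre_stabilizerP => x; case: tpermP => [->|->|]. Qed.

End FibreStabilizer.

Section Diagram.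
Variables (n : nat) (la : seq nat).
Hypothesis la_part : is_partition n la.

Definition cell_row (k : 'I_n) := reshape_index la k.
Definition cell_col (k : 'I_n) := reshape_offset la k.

Let sumla : sumn la = n. Proof. by case/and3P: la_part => _ _ /eqP. Qed.

Lemma cell_bound (k : 'I_n) :
  (cell_row k < size la)%N /\ (cell_col k < nth 0 la (cell_row k))%N.
Proof. by split; [apply: reshape_indexP | apply: reshape_offsetP]; rewrite sumla. Qed.

Lemma cell_subproof r c : (c < nth 0 la r)%N -> (flatten_index la r c < n)%N.
Proof. by move=> rc; rewrite -[n in leqRHS]sumla flatten_indexP. Qed.

Definition cell r c (rc : (c < nth 0 la r)%N) : 'I_n := Ordinal (cell_subproof rc).

Lemma cell_rowK r c rc : cell_row (@cell r c rc) = r.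
Proof. exact: flatten_indexKl. Qed.

Lemma cell_colK r c rc : cell_col (@cell r c rc) = c.
Proof. exact: flatten_indexKr. Qed.

Lemma cell_inj k1 k2 : cell_row k1 = cell_row k2 -> cell_col k1 = cell_col k2 -> k1 = k2.
Proof.
rewrite /cell_row /cell_col => er ec; apply: val_inj.
by rewrite /= -(reshape_indexK la k1) er ec reshape_indexK.
Qed.

Lemma nth_part_pos r : (r < size la)%N -> (0 < nth 0 la r)%N.
Proof.
move=> rs; rewrite lt0n; apply/eqP => e; have := mem_nth 0%N rs.
by rewrite e; case/and3P: la_part => _ /negbTE->.
Qed.

Lemma nth_part_le r : (nth 0 la r <= nth 0 la 0)%N.
Proof.
case: (ltnP r (size la)) => rs; last by rewrite (nth_default _ rs).
case/and3P: la_part => srt _ _.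
have := @sorted_leq_nth _ geq (fun a b c h1 h2 => leq_trans h2 h1) (fun a => leqnn a)
  0%N la srt 0%N r.
by rewrite !inE rs; apply=> //; apply: leq_ltn_trans rs.
Qed.

Definition first_row := [set k | cell_row k == 0%N].
Definition first_col := [set k | cell_col k == 0%N].

Lemma card_first_row : #|first_row| = head 0%N la.
Proof.
rewrite -nth0 -[RHS]card_ord -cardsT.
rewrite -(card_imset [set: _] (f := fun c : 'I_(nth 0%N la 0) => cell (ltn_ord c))).
  apply: eq_card => k; apply/idP/imsetP => [|[c _ ->]]; last by rewrite inE cell_rowK.
  rewrite inE => /eqP k0; have := (cell_bound k).2; rewrite k0 => ck.
  exists (Ordinal ck) => //; apply: cell_inj; rewrite ?cell_rowK ?cell_colK //.
by move=> c1 c2 e; apply: val_inj; rewrite /= -(cell_colK (ltn_ord c1)) e cell_colK.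
Qed.

Lemma card_first_col : #|first_col| = size la.
Proof.
rewrite -[RHS]card_ord -cardsT.
rewrite -(card_imset [set: _]
  (f := fun r : 'I_(size la) => cell (nth_part_pos (ltn_ord r)))).
  apply: eq_card => k; apply/idP/imsetP => [|[c _ ->]]; last by rewrite inE cell_colK.
  rewrite inE => /eqP k0; exists (Ordinal (cell_bound k).1) => //.
  by apply: cell_inj; rewrite ?cell_rowK ?cell_colK.
move=> c1 c2 e; apply: val_inj.
by rewrite /= -(cell_rowK (nth_part_pos (ltn_ord c1))) e cell_rowK.
Qed.

(** No part is zero, so the first part of the conjugate is the number of parts. *)
Lemma head_conj_partition : head 0%N (conj_partition la) = size la.
Proof.
rewrite /conj_partition; case: la la_part => //= x l /and3P[_ l0 _].
have pos y : y \in x :: l -> (0 < y)%N.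
  by rewrite lt0n => yl; apply: contraNneq l0 => <-.
have : (0 < x)%N by apply: pos; rewrite mem_head.
case: x {l0} pos => // x pos _ /=; rewrite add1n; congr _.+1; apply/eqP.
by rewrite -all_count; apply/allP => y yl; apply: pos; rewrite inE yl orbT.
Qed.

Lemma level_first_row_col :
  level_of n la = #|~: first_row| \/ level_of n la = #|~: first_col|.
Proof.
rewrite /level_of head_conj_partition -card_first_row -card_first_col.
have cC (S : {set 'I_n}) : (n - #|S|)%N = #|~: S|.
  by rewrite [#|~: S|]cardsCs setCK card_ord.
by rewrite !cC; case: (leqP #|~: first_row| #|~: first_col|) => _; [left|right].
Qed.

(** The first row is the longest, so it meets the column of [k]. *)
Lemma row_meets_column k : k \notin first_row ->
  exists2 i, i \in first_row & tperm i k \in fibre_stabilizer cell_col.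
Proof.
move=> _; have kc := leq_trans (cell_bound k).2 (nth_part_le _).
exists (cell kc); first by rewrite inE cell_rowK.
by apply: tperm_fibre_stabilizer; rewrite cell_colK.
Qed.

Lemma column_meets_row k : k \notin first_col ->
  exists2 i, i \in first_col & tperm i k \in fibre_stabilizer cell_row.
Proof.
move=> _; have kr := nth_part_pos (cell_bound k).1.
exists (cell kr); first by rewrite inE cell_colK.
by apply: tperm_fibre_stabilizer; rewrite cell_rowK.
Qed.

End Diagram.

Section Symmetrizer.
Variables (F : numClosedFieldType) (n : nat) (la : seq nat).
Let aG := regular_repr F [set: 'S_n]%G.
Definition row_group := fibre_stabilizer_group (@cell_row n la).
Definition column_group := fibre_stabilizer_group (@cell_col n la).

Definition coords (v : 'rV[F]_#|[set: 'S_n]%G|) (g : 'S_n) :=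
  v 0 (gring_index [set: 'S_n]%G g).

Lemma coordsJ v x g : coords (v *m aG x) g = coords v (g * x^-1)%g.
Proof.
rewrite /coords mulmx_sum_row summxE (bigD1 (gring_index [set: 'S_n]%G (g * x^-1)%g)) //=.
rewrite big1 ?addr0 => [|i ne]; rewrite !mxE eqxx /=.
  by rewrite gring_indexK ?inE // mulgKV eqxx mulr1.
case: eqP => [e|_]; last by rewrite mulr0.
case/eqP: ne; rewrite -(gring_valK i); congr gring_index.
have := congr1 enum_val e; rewrite !gring_indexK ?inE // => ->.
by rewrite mulgK.
Qed.

(** A vector of the Specht module is the Young symmetrizer times some [a] of the group
    algebra. *)
Lemma coords_young v : (v <= cyclic_mx aG (young_symmetrizer F n la))%MS ->
  exists a, coords v =1 antisymmetrized row_group column_group a.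
Proof.
case/cyclic_mxP=> A /envelop_mxP[a ->] ->; exists a => g.
have cD (I : finType) (P : pred I) (u : I -> 'rV[F]_#|[set: 'S_n]%G|) h :
    coords (\sum_(i | P i) u i) h = \sum_(i | P i) coords (u i) h by exact: summxE.
have cZ c u h : coords (c *: u) h = c * coords u h by rewrite /coords mxE.
rewrite mulmx_sumr cD.
have -> : antisymmetrized row_group column_group a g =
  \sum_(p in row_group) \sum_(q in column_group) \sum_x
    (-1) ^+ (q : bool) * (a x * (g == p * q * x)%g%:R).
  apply: eq_bigr => p _; apply: eq_bigr => q _.
  rewrite (bigD1 ((p * q)^-1 * g)%g) //= mulKVg eqxx mulr1 big1 ?addr0 // => x ne.
  case: eqP => [e|_]; last by rewrite !mulr0.
  by case/eqP: ne; rewrite e mulKg.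
rewrite (eq_bigr (fun x => \sum_(p in row_group) \sum_(q in column_group)
    (-1) ^+ (q : bool) * (a x * (g == p * q * x)%g%:R))) => [|x _].
  rewrite (eq_bigl predT) => [|x]; last by rewrite inE.
  by rewrite exchange_big; apply: eq_bigr => p _; rewrite exchange_big.
rewrite -scalemxAr cZ coordsJ cD mulr_sumr; apply: eq_bigr => p _.
rewrite cD mulr_sumr; apply: eq_bigr => q _; rewrite cZ mulrCA; congr (_ * (_ * _)).
rewrite /coords mxE eqxx /= (inj_in_eq (can_in_inj (@gring_indexK _ [set: 'S_n]%G))) ?inE //.
by rewrite (can2_eq (mulgKV x) (mulgK x)).
Qed.

Lemma coords_eigen v x r : v *m class_op aG x = r *: v ->
  forall g, \sum_t coords v (g * x^-1 ^ t)%g = r * coords v g.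
Proof.
move=> ev g; have := congr1 (fun u => coords u g) ev.
rewrite {2}/coords mxE -/(coords v g) => <-.
rewrite /class_op mulmx_sumr /coords summxE; apply: eq_big => [t|t _]; first by rewrite inE.
by rewrite -/(coords _ _) -/(coords _ _) coordsJ conjVg.
Qed.

(** The eigenvector of the class operator in the Specht module is pure on the first row. When
    the level is computed from the first column, the eigenvector is multiplied by the signed
    column sum and twisted by the sign, which is pure on the first column and changes the
    eigenvalue only by a sign. Inverses of [s] appear since the action of [x] on vectors is
    the translation of coordinates by the inverse of [x]. *)
Lemma specht_pure_eigenfunction m (rG : mx_representation F [set: 'S_n]%G m) (s : 'S_n) :
    is_partition n la -> mx_irreducible rG ->
    (forall g, \tr (specht_repr F n la g) = \tr (rG g)) ->
  exists (S : {set 'I_n}) (f : 'S_n -> F) (r : F) (g0 : 'S_n),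
    [/\ #|~: S| = level_of n la, pure_on S f, f g0 != 0,
        `|r| = n`!%:R * `|\tr (rG s) / \tr (rG 1%g)| &
        forall g, \sum_t f (g * s^-1 ^ t)%g = r * f g].
Proof.
move=> lap irr eqtr.
have [v0 v0n ev0] := shared_eigenvector (in_setT s) irr (fun g _ => eqtr g).
set r := _ * (_ / _) in ev0.
have rn : `|r| = n`!%:R * `|\tr (rG s) / \tr (rG 1%g)|.
  by rewrite /r normrM normr_nat cardsT card_Sn.
pose v := val_submod v0.
have vn : v != 0 by rewrite val_submod_eq0.
have ev : v *m class_op aG s = r *: v.
  rewrite /v -linearZ /= -ev0 !mulmx_sumr linear_sum; apply: eq_bigr => t _.
  by rewrite /= [RHS]val_submodJ ?inE.
have [a fa] := coords_young (val_submodP v0 : (v <= _)%MS).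
have [g0 fg0] : exists g, coords v g != 0.
  have [i vi] : exists i, v 0 i != 0 by apply/rV0Pn.
  by exists (enum_val i); rewrite /coords gring_valK.
set f := antisymmetrized row_group column_group a in fa.
have ef g : \sum_t f (g * s^-1 ^ t)%g = r * f g.
  by rewrite -fa -(coords_eigen ev); apply: eq_bigr => t _; rewrite fa.
rewrite fa in fg0.
case: (level_first_row_col lap) => lev.
  exists (first_row n la), f, r, g0; split=> //.
  apply: antisymmetrized_pure => [p|p|k].
  - exact: fibre_stabilizer_imset.
  - exact: perm_on_fibre_stabilizer.
  - exact: row_meets_column.
have [g1 fg1] := antisymmetrized_twist_neq0 fg0.
exists (first_col n la), (antisymmetrized column_group row_group (sign_twist f)).
exists ((-1) ^+ ((s^-1)%g : bool) * r), g1; split=> //.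
- apply: antisymmetrized_pure => [p|p|k].
  - exact: fibre_stabilizer_imset.
  - exact: perm_on_fibre_stabilizer.
  - exact: column_meets_row.
- by rewrite normrM normr_sign mul1r.
by apply: antisymmetrized_eigen; apply: sign_twist_eigen.
Qed.
End Symmetrizer.

(** * Sets weighted by their number of arcs *)

Section Counting.
Variables (R : realFieldType) (T : finType) (s : {perm T}).
Implicit Types (A B N I : {set T}) (w u : R).

Lemma ler_sum_inj (I J : finType) (f : I -> J) (F : I -> R) (G : J -> R) :
  injective f -> (forall j, 0 <= G j) -> (forall i, F i <= G (f i)) ->
  \sum_i F i <= \sum_j G j.
Proof.
move=> fI G0 FG; apply: (@le_trans _ _ (\sum_(j in f @: I) G j)).
  by rewrite big_imset /=; [apply: ler_sum | move=> ? ? _ _ /fI].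
by rewrite [leRHS](bigID [in f @: I]) lerDl sumr_ge0.
Qed.

Lemma sum_subsets_prod (I : finType) (x : I -> R) :
  \sum_(N : {set I}) \prod_(i in N) x i = \prod_i (1 + x i).
Proof.
under [RHS]eq_bigr do rewrite addrC.
rewrite bigA_distr; apply: eq_bigr => N _.
by rewrite [RHS](bigID [in N]) /= [X in _ * X]big1 ?mulr1 => [|i /negbTE->//];
  apply: eq_bigr => i ->.
Qed.

Lemma sum_subsets_expr x : \sum_(N : {set T}) x ^+ #|N| = (1 + x) ^+ #|T| :> R.
Proof.
rewrite -prodr_const -sum_subsets_prod; apply: eq_bigr => N _.
by rewrite prodr_const.
Qed.

(** The cycles of [s] cut [A] into whole cycles and arcs; this is the number of arcs. *)
Definition exits A := #|A :\: s @: A|.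

Definition exit_sum w u := \sum_(A : {set T}) w ^+ #|A| * u ^+ exits A.

Lemma card_imperm A : #|s @: A| = #|A|.
Proof. by rewrite card_imset //; apply: perm_inj. Qed.

Lemma mem_imperm A x : (s x \in s @: A) = (x \in A).
Proof. by rewrite mem_imset //; apply: perm_inj. Qed.

Lemma exits_invariant A : (exits A == 0%N) = (s @: A == A).
Proof. by rewrite cards_eq0 setD_eq0 eq_sym eqEcard card_imperm leqnn andbT. Qed.

(** Shorten every arc of [A] by its first point. What remains is [core A]; the
    predecessors of its points are in [A] as well, and the other points of [A] are the arcs of
    length one, collected in [fresh A]. So [A] is determined by [core A] and
    [fresh A], an arbitrary set of which costs the factor [(1 + u * w) ^+ #|T|]. *)
Lemma exit_sum_step w u : 0 <= w -> 0 <= u ->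
  exit_sum w u <= (1 + u * w) ^+ #|T| * exit_sum w (u * w).
Proof.
move=> w0 u0; rewrite -sum_subsets_expr mulr_suml.
under [leRHS]eq_bigr do rewrite mulr_sumr.
rewrite pair_big /=.
pose core A := A :&: s @: A.
pose fresh A := A :\: (core A :|: s @^-1: core A).
have split A : A = core A :|: s @^-1: core A :|: fresh A.
  apply/setP=> x; rewrite !inE !mem_imperm.
  by case: (x \in A); case: (s x \in A); case: (x \in s @: A).
pose f A := (fresh A, core A).
apply: (@ler_sum_inj _ _ f); last 2 first.
- by move=> [N B] /=; rewrite !(mulr_ge0, exprn_ge0).
- move=> A /=.
  have cA : #|A| = (#|core A| + exits A)%N by rewrite /exits cardsID.
  have eA : exits A = (exits (core A) + #|fresh A|)%N.
    have /eqP := cA; rewrite -(cardsID (core A) A) (setIidPr (subsetIl _ _)).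
    rewrite eqn_add2l => /eqP <-; rewrite -(cardsID (s @^-1: core A) (A :\: _)).
    congr (_ + _)%N; last by rewrite setDDl.
    rewrite -(card_imset _ (@perm_inj _ s)); apply: eq_card => x.
    apply/imsetP/setDP => [[y] | [xc nx]].
      move=> yin ->; move: yin; rewrite /core !inE !mem_imperm !inE.
      by case/and3P=> /andP[-> ->] ->.
    move: xc; rewrite /core inE => /andP[xA /imsetP[y yA xy]]; exists y => //.
    move: nx xA; rewrite xy /core !mem_imperm !inE mem_imperm yA /=.
    by move=> -> ->.
  rewrite cA eA exprD !exprMn !exprD le_eqVlt; apply/orP; left; apply/eqP; ring.
by move=> A1 A2 [e1 e2]; rewrite (split A1) (split A2) e1 e2.
Qed.

Lemma exit_sum_ge0 w u : 0 <= w -> 0 <= u -> 0 <= exit_sum w u.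
Proof. by move=> w0 u0; apply: sumr_ge0 => A _; rewrite mulr_ge0 ?exprn_ge0. Qed.

(** The arcs get shorter at each step, so the weight of an arc tends to 0 and in the limit only
    the unions of cycles remain. *)
Lemma exit_sum_iter w u m : 0 <= w -> 0 <= u ->
  exit_sum w u
    <= (\prod_(1 <= j < m.+1) (1 + u * w ^+ j)) ^+ #|T| * exit_sum w (u * w ^+ m).
Proof.
move=> w0 u0; elim: m => [|m IH]; first by rewrite big_geq // expr1n mul1r expr0 mulr1.
apply: le_trans IH _; rewrite [in leRHS]big_nat_recr //= exprMn -mulrA.
rewrite ler_wpM2l // ?exprn_ge0 ?prodr_ge0 // => [j _|].
  by rewrite addr_ge0 ?mulr_ge0 ?exprn_ge0.
by rewrite exprSr mulrA; apply: exit_sum_step; rewrite ?mulr_ge0 ?exprn_ge0.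
Qed.

Lemma exit_sum_invariant w :
  exit_sum w 0 = \sum_(A : {set T} | s @: A == A) w ^+ #|A|.
Proof.
rewrite [RHS]big_mkcond; apply: eq_bigr => A _; rewrite -exits_invariant.
by rewrite expr0n; case: ifP; rewrite ?mulr1 ?mulr0.
Qed.

Lemma exit_sum_near0 w u : 0 <= w <= 1 -> 0 <= u <= 1 ->
  exit_sum w u <= exit_sum w 0 + 2 ^+ #|T| * u.
Proof.
move=> /andP[w0 w1] /andP[u0 u1].
rewrite [2 ^+ _](_ : _ = \sum_(A : {set T}) 1); last first.
  by rewrite (_ : 2 = 1 + 1) // -sum_subsets_expr; apply: eq_bigr => A _; rewrite expr1n.
rewrite mulr_suml -big_split /=; apply: ler_sum => A _; rewrite mul1r expr0n.
case: (exits A) => [|t]; first by rewrite lerDl.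
rewrite mulr0 add0r exprS mulrCA ler_piMr // mulr_ile1 ?exprn_ge0 //.
  exact: exprn_ile1.
exact: exprn_ile1.
Qed.

Lemma porbit_invariant A x : s @: A = A -> x \in A -> porbit s x \subset A.
Proof.
move=> sA xA; apply/subsetP=> y /porbitP[i ->].
by elim: i => [|i IH]; rewrite ?expg0 ?perm1 // expgSr permM -sA mem_imperm.
Qed.

Lemma partition_porbits A : s @: A = A -> partition [set porbit s x | x in A] A.
Proof.
move=> sA; rewrite (_ : imset _ _ = preim_partition (porbit s) A).
  exact: preim_partitionP.
have e x : x \in A -> porbit s x = [set y in A | porbit s x == porbit s y].
  move=> xA; apply/setP=> y; rewrite !inE eq_sym eq_porbit_mem andbC.
  case: (boolP (y \in porbit s x)) => //= yx.
  by apply/esym/(subsetP (porbit_invariant sA xA)).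
by apply/setP=> B; apply/imsetP/imsetP => -[x xA ->]; exists x; rewrite // -e.
Qed.

(** An invariant set is a union of cycles, and distinct invariant sets are made of distinct
    families of cycles. *)
Lemma invariant_sum_le w : 0 <= w ->
  \sum_(A : {set T} | s @: A == A) w ^+ #|A|
    <= \prod_(B in porbits s) (1 + w ^+ #|B|).
Proof.
move=> w0; pose orbs A := [set porbit s x | x in A].
have -> : \prod_(B in porbits s) (1 + w ^+ #|B|)
    = \sum_(Q : {set {set T}})
        if Q \subset porbits s then \prod_(B in Q) w ^+ #|B| else 0.
  pose x B := if B \in porbits s then w ^+ #|B| else 0.
  rewrite big_mkcond (eq_bigr (fun B => 1 + x B)) => [|B _]; last first.
    by rewrite /x; case: ifP; rewrite ?addr0.
  rewrite -sum_subsets_prod; apply: eq_bigr => Q _; case: ifPn => [/subsetP sQ | ].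
    by apply: eq_bigr => B /sQ; rewrite /x => ->.
  by case/subsetPn=> B BQ /negbTE nB; rewrite (bigD1 B BQ) /= /x nB mul0r.
rewrite (eq_bigr (fun A => \prod_(B in orbs A) w ^+ #|B|)) => [|A /eqP sA].
  rewrite -(big_imset (fun Q : {set {set T}} => \prod_(B in Q) w ^+ #|B|)) /=; last first.
    move=> A B hA hB e.
    have sA : s @: A = A by apply/eqP.
    have sB : s @: B = B by apply/eqP.
    rewrite -(cover_partition (partition_porbits sA)).
    by rewrite -(cover_partition (partition_porbits sB)) [imset _ _]e.
  rewrite [leRHS]big_mkcond [leLHS]big_mkcond /=; apply: ler_sum => Q _.
  case: ifP => [/imsetP[A _ ->]|_]; last first.
    by case: ifP => // _; apply: prodr_ge0 => B _; rewrite exprn_ge0.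
  rewrite ifT //; apply/subsetP=> B /imsetP[x _ ->]; exact: imset_f.
by rewrite prodrXr; congr (_ ^+ _); rewrite (card_partition (partition_porbits sA)).
Qed.

End Counting.

(** * Random sets *)

Section Equi.
Variable T : finType.
Implicit Types (A B S : {set T}) (s t p : {perm T}).

Lemma perm_imset_eqcard A B : #|A| = #|B| -> exists p, p @: A = B.
Proof.
move=> eAB; pose l (X : {set T}) := enum X ++ enum (~: X).
have ul X : uniq (l X).
  rewrite cat_uniq !enum_uniq andbT /=; apply/hasPn => x.
  by rewrite !mem_enum inE.
have ml X x : x \in l X by rewrite mem_cat !mem_enum inE orbN.
have sl X : size (l X) = #|T| by rewrite size_cat -!cardE cardsC.
(* matches the listing of T that begins with A to the one that begins with B *)
pose f x := nth x (l B) (index x (l A)).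
have fI : injective f.
  move=> x y; have ix z : (index z (l A) < size (l B))%N.
    by rewrite sl -(sl A) index_mem ml.
  rewrite /f (set_nth_default y) // => /eqP; rewrite nth_uniq // => /eqP e.
  by rewrite -(nth_index x (ml A x)) e (set_nth_default y) ?nth_index // sl -(sl B) ix.
exists (perm fI); apply/eqP.
rewrite eqEcard card_imset ?eAB ?leqnn ?andbT; last exact: perm_inj.
apply/subsetP=> _ /imsetP[x xA ->]; rewrite permE /f !index_cat mem_enum xA.
have ix : (index x (enum A) < #|B|)%N by rewrite -eAB cardE index_mem mem_enum.
by rewrite nth_cat -cardE ix -mem_enum mem_nth // -cardE.
Qed.

(** A uniform permutation sends [B] to a uniform set of the same size. *)
Lemma sum_perm_imset (R : numFieldType) (phi : {set T} -> R) B :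
  'C(#|T|, #|B|)%:R * \sum_(p : {perm T}) phi (p @: B)
    = #|T|`!%:R * \sum_(A : {set T} | #|A| == #|B|) phi A.
Proof.
have e A : #|A| == #|B| ->
    \sum_(p : {perm T}) phi (p @: B) = \sum_(p : {perm T}) phi (p @: A).
  move=> /eqP/perm_imset_eqcard[q <-]; rewrite [RHS](reindex_inj (mulgI q)) /=.
  apply: eq_bigr => p _; rewrite -imset_comp; congr phi; apply: eq_imset => x.
  by rewrite /= permM.
rewrite -card_draws mulr_natl -sumr_const.
rewrite (eq_bigl (fun A : {set T} => #|A| == #|B|)) => [|A]; last by rewrite inE.
rewrite (eq_bigr _ e) exchange_big /=.
rewrite [#|T|`!](_ : _ = #|[set: {perm T}]|); last first.
  rewrite -[in LHS]cardsT -card_perm cardsT; apply: eq_card => p; rewrite !inE.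
  by apply/subsetP => x _.
rewrite mulr_natl -sumr_const; apply: eq_big => [p|p _]; first by rewrite inE.
have injp := imset_inj (@perm_inj _ p).
rewrite [RHS](reindex_inj injp) /=; apply: eq_bigl => A.
by rewrite card_imset //; apply: perm_inj.
Qed.

Lemma mem_imset_perm p A x : (x \in p @: A) = ((p^-1)%g x \in A).
Proof. by rewrite -[in LHS](permKV p x) mem_imset //; apply: perm_inj. Qed.

Lemma crossings_exits S s t : crossings S (s^-1 ^ t^-1)%g = exits s (t @: (~: S)).
Proof.
rewrite /crossings /exits -(card_imset _ (@perm_inj _ t)); apply: eq_card => x.
rewrite mem_imset_perm in_setD !mem_imset_perm !inE -{2}(permKV t x).
by rewrite conjgE invgK !permM permKV negbK andbC permKV.
Qed.
End Equi.

(** For a uniform [t], the number of crossings of the conjugate of [s^-1] by [t] is the number of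
    exits of a uniform set of size [#|~: S|]. *)
Lemma pure_ratio_bound (K : numFieldType) n (S : {set 'I_n}) (f : 'S_n -> K) (r : K)
    (s g0 : 'S_n) (z : K) :
    pure_on S f -> f g0 != 0 -> `|r| = n`!%:R * `|z| ->
    (forall g, \sum_t f (g * s^-1 ^ t)%g = r * f g) ->
  `|z| * 'C(n, #|~: S|)%:R
    <= \sum_(A : {set 'I_n} | #|A| == #|~: S|) ('C(n - #|~: S|, exits s A)%:R)^-1.
Proof.
move=> pf f0 rz ef; have := pure_eigenvalue_bound pf f0 ef; rewrite rz.
have fp : 0 < n`!%:R :> K by rewrite ltr0n fact_gt0.
have -> : #|S| = (n - #|~: S|)%N.
  by rewrite [#|~: S|]cardsCs setCK card_ord subKn // -[leqRHS]card_ord max_card.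
rewrite (reindex_inj invg_inj) /=; under eq_bigr do rewrite crossings_exits.
move=> h; rewrite -(ler_pM2l fp) mulrA.
have := sum_perm_imset (fun A : {set 'I_n} => ('C(n - #|~: S|, exits s A)%:R)^-1 : K) (~: S).
by rewrite card_ord => <-; rewrite mulrC; apply: ler_wpM2l.
Qed.

(** * Cycles and the order of the centralizer *)

Section Centralizer.
Variables (T : finType) (s : {perm T}).

Definition fixed_points := [set x | s x == x].
Definition long_cycles := [set B in porbits s | (1 < #|B|)%N].

(** Every permutation supported on the fixed points of [s] commutes with [s]. *)
Lemma fact_fixed_le_cent : (#|fixed_points|`! <= #|'C[s]%g|)%N.
Proof.
rewrite -card_perm; apply: subset_leq_card; apply/subsetP=> p pp.
apply/cent1P/permP=> x; rewrite !permM.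
have sF y : y \in fixed_points -> s y = y by rewrite inE => /eqP.
case: (boolP (x \in fixed_points)) => xF.
  by rewrite (sF x xF) sF // (perm_closed _ pp).
rewrite (out_perm pp xF) (out_perm pp) //; apply: contra xF.
by rewrite !inE (inj_eq perm_inj).
Qed.

(** The restrictions of [s] to unions of its nontrivial cycles commute with [s], and they are
    distinct because the union can be read off as the set of moved points. *)
Lemma pow2_cycles_le_cent : (2 ^ #|long_cycles| <= #|'C[s]%g|)%N.
Proof.
have porbit1 x : porbit s (s x) = porbit s x.
  by have := porbit_perm s 1 x; rewrite expg1.
have moves B : B \in long_cycles -> forall x, x \in B -> s x != x.
  rewrite inE => /andP[/imsetP[y _ ->] gt1] x; rewrite -eq_porbit_mem => /eqP e.
  apply: contraTneq gt1 => sx; rewrite -e -leqNgt.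
  suff /subset_leq_card : porbit s x \subset [set x] by rewrite cards1.
  apply/subsetP=> z /porbitP[i ->]; rewrite inE; apply/eqP.
  by elim: i => [|i IH]; rewrite ?expg0 ?perm1 // expgSr permM IH.
have cov (Q : {set {set T}}) x :
    Q \subset long_cycles -> (s x \in cover Q) = (x \in cover Q).
  move=> /subsetP QL; apply/bigcupP/bigcupP => -[B BQ xB]; exists B => //;
    move: (QL B BQ) xB; rewrite inE => /andP[/imsetP[y _ ->] _].
    by rewrite -!eq_porbit_mem porbit1.
  by rewrite -!eq_porbit_mem porbit1.
pose restr (Q : {set {set T}}) := restr_perm (cover Q) s.
have restrE (Q : {set {set T}}) x : Q \subset long_cycles ->
    restr Q x = if x \in cover Q then s x else x.
  move=> QL; case: ifPn => xQ; last by rewrite (out_perm (restr_perm_on _ _)).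
  by rewrite restr_permE //; apply/astabsP => y; rewrite /= apermE cov.
have restrC (Q : {set {set T}}) : commute (restr Q) s by exact: restr_perm_commute.
clearbody restr; rewrite -card_powerset -(card_in_imset (f := restr)) => [|Q1 Q2].
  apply: subset_leq_card; apply/subsetP=> p /imsetP[Q _ ->].
  exact/cent1P.
rewrite !inE => QL1 QL2 eQ.
have sub (Q Q' : {set {set T}}) : Q \subset long_cycles -> Q' \subset long_cycles ->
    restr Q = restr Q' -> Q \subset Q'.
  move=> QL QL' e; apply/subsetP=> B BQ.
  have BL := subsetP QL B BQ; have := BL; rewrite inE => /andP[/imsetP[x _ Bx] _].
  have xB : x \in B by rewrite Bx porbit_id.
  have := restrE _ x QL; rewrite e restrE //.
  have -> : x \in cover Q by apply/bigcupP; exists B.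
  case: ifP => [/bigcupP[B' B'Q xB'] _ | _ /esym/eqP]; last first.
    by rewrite (negbTE (moves B BL x xB)).
  suff -> : B = B' by [].
  move: (subsetP QL' B' B'Q) xB'; rewrite inE => /andP[/imsetP[y _ ->] _].
  by rewrite -eq_porbit_mem Bx => /eqP.
by apply/eqP; rewrite eqEsubset; apply/andP; split; apply: sub.
Qed.

Lemma card_short_cycles : (#|[set B in porbits s | #|B| <= 1]%N| <= #|fixed_points|)%N.
Proof.
rewrite -(card_in_imset (f := fun x => [set x]) (D := fixed_points)) => [|x y _ _ /set1_inj//].
apply: subset_leq_card; apply/subsetP=> B; rewrite inE => /andP[/imsetP[x _ ->] le1].
have e : porbit s x = [set x].
  by apply/esym/eqP; rewrite eqEcard cards1 le1 andbT sub1set porbit_id.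
apply/imsetP; exists x; rewrite // inE; apply/eqP/set1P.
by rewrite -e; have := mem_porbit s 1 x; rewrite expg1.
Qed.

Lemma cycle_prod_le (R : realFieldType) (w : R) : 0 <= w <= 1 ->
  \prod_(B in porbits s) (1 + w ^+ #|B|)
    <= (1 + w) ^+ #|fixed_points| * (1 + w ^+ 2) ^+ #|long_cycles|.
Proof.
move=> /andP[w0 w1]; rewrite (bigID (fun B : {set T} => #|B| <= 1)%N) /=.
apply: ler_pM.
- by apply: prodr_ge0 => B _; rewrite addr_ge0 ?exprn_ge0.
- by apply: prodr_ge0 => B _; rewrite addr_ge0 ?exprn_ge0.
- apply: (@le_trans _ _ (\prod_(B in porbits s | (#|B| <= 1)%N) (1 + w))).
    apply: ler_prod => B /andP[/imsetP[x _ ->] le1].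
    rewrite addr_ge0 ?exprn_ge0 //= lerD2l; have := card_porbit_neq0 s x.
    by case: #|_| le1 => [|[]].
  rewrite prodr_const ler_weXn2l ?lerDl //.
  apply: leq_trans card_short_cycles; apply: subset_leq_card.
  by apply/subsetP=> B; rewrite !inE.
- rewrite -prodr_const [leRHS](eq_bigl (fun B => (B \in porbits s) && ~~ (#|B| <= 1)%N)).
    apply: ler_prod => B /andP[_]; rewrite -ltnNge => gt1.
    by rewrite addr_ge0 ?exprn_ge0 //= lerD2l ler_wiXn2l.
  by move=> B; rewrite inE -ltnNge.
Qed.

End Centralizer.

Lemma card_class_cent n (s : 'S_n) : (#|(s ^: [set: 'S_n])%g| * #|'C[s]%g| = n`!)%N.
Proof.
rewrite -index_cent1 setTI mulnC Lagrange ?subsetT // -card_Sn.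
by apply: eq_card => p; rewrite !inE.
Qed.

(** * Estimates *)

From mathcomp Require Import complex.
From mathcomp Require Import all_classical all_reals all_analysis.
Import Order.TTheory GRing.Theory Num.Theory.

(** Each factor [(m - j) / (j + 1)] of the binomial coefficient is at least [(m - d) / d]. *)
Lemma bin_geometric m d t : (t <= d <= m)%N -> ((m - d) ^ t <= 'C(m, t) * d ^ t)%N.
Proof.
case/andP; elim: t => [|t IH] td dm; first by rewrite bin0.
have := IH (ltnW td) dm => {}IH; rewrite -(leq_pmul2l (ltn0Sn t)) mulnA mul_bin_left.
rewrite !expnS mulnCA -mulnA; apply: leq_mul; first by rewrite leq_sub2l // ltnW.
by rewrite mulnCA; apply: leq_mul.
Qed.

Section Numeric.
Variable R : realType.
Implicit Types (x w u y D L : R).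

(** By induction from [(1 + 1 / f) ^+ f <= expR 1]. *)
Lemma pow_le_fact_expR f : f%:R ^+ f <= f`!%:R * expR f%:R :> R.
Proof.
elim: f => [|f IH]; first by rewrite expr0 mul1r -[1]expR0.
have [->|f0] := eqVneq f 0%N.
  by rewrite expr1 mul1r (le_trans _ (expR_ge1Dx 1)) // lerDl.
have fp : 0 < f%:R :> R by rewrite ltr0n lt0n.
rewrite exprS factS natrM -mulrA ler_wpM2l ?ler0n // -natr1 expRD.
rewrite mulrA; apply: le_trans (ler_wpM2r (expR_ge0 _) IH).
have -> : f%:R + 1 = f%:R * (1 + f%:R^-1) :> R by rewrite mulrDr mulr1 mulfV ?gt_eqF.
rewrite exprMn ler_wpM2l ?exprn_ge0 ?ler0n //.
have -> : expR 1 = expR f%:R^-1 ^+ f :> R by rewrite -expRM_natr mulVf ?gt_eqF.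
by rewrite lerXn2r ?nnegrE ?expR_ge0 ?addr_ge0 ?invr_ge0 ?ler0n // expR_ge1Dx.
Qed.

Lemma exit_sum_le_invariant (T : finType) (s : {perm T}) w u :
    0 <= w <= 2^-1 -> 0 <= u <= 1 ->
  exit_sum s w u <= expR (2 * #|T|%:R * u * w) * exit_sum s w 0.
Proof.
move=> /andP[w0 w2] /andP[u0 u1].
have w1 : w <= 1 by lra.
set E := expR _; have E0 : 0 < E by apply: expR_gt0.
have geom m : \sum_(1 <= j < m.+1) w ^+ j <= 2 * w - 2 * w ^+ m.+1.
  elim: m => [|m IH]; first by rewrite big_geq // expr1 subrr.
  rewrite big_nat_recr //=; apply: le_trans (lerD IH (lexx _)) _.
  have : w * w ^+ m.+1 <= 2^-1 * w ^+ m.+1 by rewrite ler_wpM2r ?exprn_ge0.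
  by rewrite -exprS; lra.
have prodE m : (\prod_(1 <= j < m.+1) (1 + u * w ^+ j)) ^+ #|T| <= E.
  apply: (@le_trans _ _ (expR (u * (2 * w)) ^+ #|T|)); last first.
    by rewrite -expRM_natr /E le_eqVlt; apply/orP; left; apply/eqP; congr expR; ring.
  rewrite lerXn2r ?nnegrE ?expR_ge0 // ?prodr_ge0 // => [j _|].
    by rewrite addr_ge0 ?mulr_ge0 ?exprn_ge0.
  apply: (@le_trans _ _ (expR (u * \sum_(1 <= j < m.+1) w ^+ j))).
    rewrite mulr_sumr expR_sum; apply: ler_prod => j _.
    by rewrite expR_ge1Dx addr_ge0 ?mulr_ge0 ?exprn_ge0.
  rewrite ler_expR ler_wpM2l //; apply: le_trans (geom m) _.
  by rewrite gerBl mulr_ge0 ?exprn_ge0.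
(* after m steps only sets without arcs count, up to an error that is geometric in m *)
apply/ler_addgt0Pr => e e0.
pose X := E * 2 ^+ #|T| / e; have [m Xm] : exists m, X <= 2 ^+ m.
  by exists (Num.bound X); apply/ltW/upper_nthrootP.
have w2m : w ^+ m <= 2 ^- m by rewrite -exprVn lerXn2r ?nnegrE ?invr_ge0.
apply: le_trans (exit_sum_iter s m w0 u0) _.
apply: (@le_trans _ _ (E * (exit_sum s w 0 + 2 ^+ #|T| * 2 ^- m))).
  apply: ler_pM => //.
  - by rewrite exprn_ge0 ?prodr_ge0 // => j _; rewrite addr_ge0 ?mulr_ge0 ?exprn_ge0.
  - by rewrite exit_sum_ge0 ?mulr_ge0 ?exprn_ge0.
  - have uw : 0 <= u * w ^+ m <= 1.
      by rewrite mulr_ge0 ?exprn_ge0 //= mulr_ile1 ?exprn_ge0 ?exprn_ile1.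
    apply: le_trans (exit_sum_near0 s _ uw) _; first by rewrite w0.
    rewrite lerD2l ler_wpM2l ?exprn_ge0 //; apply: le_trans w2m.
    by rewrite ler_piMl ?exprn_ge0.
rewrite mulrDr lerD2l mulrA ler_pdivrMr ?exprn_gt0 // [leRHS]mulrC.
by move: Xm; rewrite /X ler_pdivrMr.
Qed.

(** Weighting each point by [y^-1] picks out the sets of size [d] at the price of [y ^+ d]. *)
Lemma exit_count_le (T : finType) (s : {perm T}) (d : nat) y u :
    2 <= y -> 0 <= u <= 1 ->
  \sum_(A : {set T} | #|A| == d) u ^+ exits s A
    <= y ^+ d * expR (2 * #|T|%:R * u / y + #|fixed_points s|%:R / y
                      + #|long_cycles s|%:R / y ^+ 2).
Proof.
move=> y2 u01; have y0 : 0 < y by lra.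
have w01 : 0 <= y^-1 <= 2^-1 by rewrite invr_ge0 ltW //= lef_pV2 ?posrE.
have w1 : 0 <= y^-1 <= 1 by lra.
have u0 : 0 <= u by case/andP: u01.
apply: (@le_trans _ _ (y ^+ d * exit_sum s y^-1 u)).
  rewrite /exit_sum mulr_sumr [leRHS](bigID (fun A : {set T} => #|A| == d)) /=.
  rewrite -[leLHS]addr0; apply: lerD; last first.
    by apply: sumr_ge0 => A _; rewrite !mulr_ge0 ?exprn_ge0 ?invr_ge0 // ltW.
  by apply: ler_sum => A /eqP ->; rewrite mulrA exprVn mulfV ?mul1r // expf_neq0 ?gt_eqF.
rewrite ler_wpM2l ?exprn_ge0 ?(ltW y0) // -addrA expRD.
apply: le_trans (exit_sum_le_invariant s w01 u01) _.
rewrite ler_wpM2l ?expR_ge0 // exit_sum_invariant.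
apply: le_trans (invariant_sum_le s _) _; first by case/andP: w1.
apply: le_trans (cycle_prod_le s w1) _; rewrite expRD -exprVn.
apply: ler_pM; rewrite ?exprn_ge0 ?addr_ge0 ?exprn_ge0 //; try by case/andP: w1.
  rewrite mulrC expRM_natr lerXn2r ?nnegrE ?expR_ge0 ?addr_ge0 ?expR_ge1Dx //.
  by case/andP: w1.
rewrite mulrC expRM_natr lerXn2r ?nnegrE ?expR_ge0 ?addr_ge0 ?expR_ge1Dx ?exprn_ge0 //.
by case/andP: w1.
Qed.

End Numeric.

Section Final.
Variable R : realType.
Implicit Types (r D L : R).

Lemma inv_bin_le1 a b : ('C(a, b)%:R)^-1 <= 1 :> R.
Proof.
case: 'C(a, b) => [|k]; first by rewrite invr0.
by rewrite invf_le1 ?ltr0n // ler1n.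
Qed.

(** The right-hand side has [C(n, d)] terms, each at most 1. *)
Lemma ratio_le1 n d (s : 'S_n) r : (d <= n)%N ->
    r * 'C(n, d)%:R <= \sum_(A : {set 'I_n} | #|A| == d) ('C(n - d, exits s A)%:R)^-1 ->
  r <= 1.
Proof.
move=> dn; have C0 : 0 < 'C(n, d)%:R :> R by rewrite ltr0n bin_gt0.
move=> h; rewrite -(ler_pM2r C0) mul1r; apply: le_trans h _.
rewrite -[n in leRHS]card_ord -card_draws -sumr_const.
rewrite [leRHS](eq_bigl (fun A : {set 'I_n} => #|A| == d)) => [|A]; last by rewrite inE.
by apply: ler_sum => A _; apply: inv_bin_le1.
Qed.

Lemma inv_bin_le_expr n d t : (t <= d)%N -> (0 < d)%N -> (4 * d <= n)%N ->
  ('C(n - d, t)%:R)^-1 <= (2 * d%:R / n%:R) ^+ t :> R.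
Proof.
move=> td d0 dn; have n0 : 0 < n%:R :> R by rewrite ltr0n; lia.
have dp : 0 < d%:R :> R by rewrite ltr0n.
have C0 : 0 < 'C(n - d, t)%:R :> R by rewrite ltr0n bin_gt0; lia.
have dnR : 4 * d%:R <= n%:R :> R by rewrite -natrM ler_nat.
have h : (n%:R / 2) ^+ t <= 'C(n - d, t)%:R * d%:R ^+ t :> R.
  apply: (@le_trans _ _ ((n - d - d)%:R ^+ t)); last first.
    by rewrite -!natrX -natrM ler_nat bin_geometric //; lia.
  rewrite lerXn2r ?nnegrE ?ler0n ?divr_ge0 // !natrB; first lra.
    lia.
  lia.
have -> : 2 * d%:R / n%:R = d%:R / (n%:R / 2) :> R by field; rewrite gt_eqF.
rewrite expr_div_n ler_pdivlMr ?exprn_gt0 ?divr_gt0 // mulrC ler_pdivrMr //.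
by rewrite [leRHS]mulrC.
Qed.

Lemma bin_ge_expr n d : (0 < d)%N -> (4 * d <= n)%N ->
  (n%:R / (2 * d%:R)) ^+ d <= 'C(n, d)%:R :> R.
Proof.
move=> d0 dn; have dp : 0 < d%:R :> R by rewrite ltr0n.
have dnR : 4 * d%:R <= n%:R :> R by rewrite -natrM ler_nat.
have -> : n%:R / (2 * d%:R) = (n%:R / 2) / d%:R :> R by field; rewrite gt_eqF.
rewrite expr_div_n ler_pdivrMr ?exprn_gt0 //.
apply: (@le_trans _ _ ((n - d)%:R ^+ d)); last first.
  by rewrite -!natrX -natrM ler_nat bin_geometric //; lia.
by rewrite lerXn2r ?nnegrE ?ler0n ?divr_ge0 // natrB; [lra|lia].
Qed.

(** If the right-hand side is at least 1 then [r <= 1] suffices; otherwise [4 * d <= n], and the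
    inverse binomial coefficients are bounded by powers of [u = 2 * d / n]. The weight [y] is
    the largest allowed by the target, namely a constant times [(D / d) / ln (D / d)], and it
    makes every term of the exponent in [exit_count_le] at most [d]: the fixed points number at
    most [d * y] because their factorial is at most [expR (2 * D)], and the longer cycles at
    most [4 * D], which is at most [d * y ^+ 2]. *)
Lemma ratio_bound n d (s : 'S_n) r D : (0 < d)%N -> (d <= n)%N -> d%:R <= D ->
    #|'C[s]%g|%:R <= expR (2 * D) -> 0 <= r ->
    r * 'C(n, d)%:R <= \sum_(A : {set 'I_n} | #|A| == d) ('C(n - d, exits s A)%:R)^-1 ->
    ln D - ln d%:R != 0 ->
  r <= (8 * expR 4 * D / (n%:R * (ln D - ln d%:R))) ^+ d.
Proof.
move=> d0 dn dD cent r0 hr; set L := ln D - ln d%:R => L0.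
have dp : 0 < d%:R :> R by rewrite ltr0n.
have n0 : 0 < n%:R :> R by rewrite ltr0n (leq_trans d0).
have Dp : 0 < D by apply: lt_le_trans dp dD.
have Lp : 0 < L by rewrite lt0r L0 subr_ge0 ler_ln.
have r1 := ratio_le1 dn hr.
pose e : R := expR 1; have e2 : 2 <= e by have := expR_ge1Dx (1 : R); rewrite /e; lra.
have e4 : expR 4 = e ^+ 4 by rewrite /e -expRM_natr mul1r.
(* L is the logarithm of D / d and q is the square root of D / d, so L is at most 2 * q *)
pose q := expR (L / 2); have q0 : 0 < q by apply: expR_gt0.
have Dq : D = d%:R * q ^+ 2.
  rewrite /q -expRM_natr mulfVK // /L expRD expRN !lnK ?posrE //.
  by rewrite mulrCA mulfV ?mulr1 ?gt_eqF.
have Lq : L / 2 < q by have := expR_ge1Dx (L / 2); rewrite -/q; lra.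
case: (leP (n%:R * L) (8 * expR 4 * D)) => [triv|small].
  apply: le_trans r1 _; rewrite exprn_ege1 // ler_pdivlMr ?mulr_gt0 // mul1r.
  exact: triv.
have q1 : 1 <= q by rewrite /q -expR0 ler_expR divr_ge0 // ltW.
have Lqq : L <= q ^+ 2.
  have := expR_ge1Dx (L / 2); rewrite -/q; have := sqr_ge0 (q - 1).
  by rewrite sqrrB expr1n mulr1; lra.
have e4gt : 1 <= expR 4 :> R by rewrite -expR0 ler_expR.
have dn4R : 4 * d%:R <= n%:R :> R.
  rewrite -(ler_pM2r (exprn_gt0 2 q0)).
  have h1 : n%:R * L <= n%:R * q ^+ 2 by rewrite ler_wpM2l // ltW.
  have h2 : D <= expR 4 * D by rewrite ler_peMl // ltW.
  by move: h2 Dp; rewrite -mulrA -Dq; lra.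
have dn4 : (4 * d <= n)%N by rewrite -(ler_nat R) natrM.
pose y := 4 * e * q ^+ 2 / L.
have yL : y * L = 4 * e * q ^+ 2 by rewrite /y mulfVK.
have y8 : 8 <= y.
  rewrite /y ler_pdivlMr //; apply: (@le_trans _ _ (8 * q ^+ 2)); first by rewrite ler_wpM2l.
  by rewrite ler_wpM2r ?exprn_ge0 ?(ltW q0) //; lra.
have y0 : 0 < y by lra.
have yq : 2 * e * q <= y.
  rewrite /y ler_pdivlMr //.
  have -> : 4 * e * q ^+ 2 = 2 * e * q * (2 * q) by ring.
  by rewrite ler_wpM2l ?mulr_ge0 ?(ltW q0) //; lra.
have f_le : #|fixed_points s|%:R <= d%:R * y.
  (* if f > d * y then f ^ f would exceed e ^ (2 * D + f), hence also f! * e ^ f *)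
  rewrite leNgt; apply/negP; set f := #|_| => fbig.
  have fp : 0 < f%:R :> R by apply: lt_trans fbig; rewrite mulr_gt0.
  have feq : expR (1 + L / 2) <= f%:R.
    rewrite expRD -/q -/e; apply: ltW; apply: le_lt_trans fbig.
    apply: le_trans (_ : y <= _); last by rewrite ler_peMl ?(ltW y0) // ler1n.
    have eq0 : 0 <= e * q by rewrite mulr_ge0 ?(ltW q0) //; lra.
    by apply: le_trans yq; rewrite -mulrA; lra.
  have : expR ((1 + L / 2) * f%:R) <= expR (2 * D + f%:R).
    rewrite expRM_natr [leRHS]expRD; apply: (@le_trans _ _ (f%:R ^+ f)).
      by rewrite lerXn2r ?nnegrE ?expR_ge0 ?ler0n.
    apply: le_trans (pow_le_fact_expR R f) _; rewrite ler_wpM2r ?expR_ge0 //.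
    by apply: le_trans cent; rewrite ler_nat fact_fixed_le_cent.
  rewrite ler_expR => hL.
  have : d%:R * y * L < f%:R * L by rewrite ltr_pM2r.
  rewrite -mulrA yL => hf.
  have : 8 * D <= 4 * e * D by rewrite ler_wpM2r ?(ltW Dp) //; lra.
  rewrite {2}Dq; lra.
have c_le : #|long_cycles s|%:R <= 4 * D.
  have half : expR 2^-1 <= 2 :> R.
    have := expR_ge1Dx (- 2^-1 : R); rewrite expRN => h.
    rewrite -[leRHS]invrK -[leLHS]invrK lef_pV2 ?posrE ?invr_gt0 ?expR_gt0 //.
    lra.
  have : expR (2^-1 * #|long_cycles s|%:R) <= expR (2 * D).
    rewrite expRM_natr; apply: le_trans cent.
    apply: (@le_trans _ _ (2 ^+ #|long_cycles s|)).
      by rewrite lerXn2r ?nnegrE ?expR_ge0.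
    by rewrite -natrX ler_nat pow2_cycles_le_cent.
  by rewrite ler_expR; lra.
have fy : #|fixed_points s|%:R / y <= d%:R by rewrite ler_pdivrMr.
have cy : #|long_cycles s|%:R / y ^+ 2 <= d%:R.
  rewrite ler_pdivrMr ?exprn_gt0 //; apply: le_trans c_le _; rewrite Dq.
  have -> : 4 * (d%:R * q ^+ 2) = d%:R * (2 * q) ^+ 2 by ring.
  rewrite ler_wpM2l ?(ltW dp) // lerXn2r ?nnegrE ?(ltW y0) ?mulr_ge0 ?(ltW q0) //.
  by apply: le_trans yq; rewrite ler_wpM2r ?(ltW q0) //; lra.
pose u : R := 2 * d%:R / n%:R.
have u01 : 0 <= u <= 1.
  by rewrite divr_ge0 ?mulr_ge0 ?(ltW n0) ?(ltW dp) //= ler_pdivrMr // mul1r; lra.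
have ny : 2 * n%:R * u / y <= d%:R.
  rewrite ler_pdivrMr // (_ : 2 * n%:R * u = d%:R * 4); last first.
    by rewrite /u; field; rewrite gt_eqF.
  by rewrite ler_wpM2l ?(ltW dp) //; lra.
have main : r * 'C(n, d)%:R <= y ^+ d * expR 3 ^+ d.
  apply: le_trans hr _.
  apply: (@le_trans _ _ (\sum_(A : {set 'I_n} | #|A| == d) u ^+ exits s A)).
    apply: ler_sum => A /eqP cA; apply: inv_bin_le_expr => //.
    by rewrite -cA subset_leq_card // subsetDl.
  apply: le_trans (exit_count_le s d (_ : 2 <= y) u01) _; first lra.
  rewrite ler_wpM2l ?exprn_ge0 ?(ltW y0) // -expRM_natr ler_expR card_ord.
  by lra.
have b0 : 0 < (n%:R / (2 * d%:R)) ^+ d :> R by rewrite exprn_gt0 ?divr_gt0 ?mulr_gt0.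
rewrite -(ler_pM2r b0); apply: (@le_trans _ _ (r * 'C(n, d)%:R)).
  by rewrite ler_wpM2l // bin_ge_expr.
apply: le_trans main _; rewrite -!exprMn le_eqVlt; apply/orP; left; apply/eqP.
congr (_ ^+ _); rewrite Dq e4 (_ : expR 3 = e ^+ 3); last by rewrite /e -expRM_natr mul1r.
rewrite /y; field.
by rewrite !gt_eqF.
Qed.
End Final.

(** * The character bound *)

Lemma scale_powR (R : realType) (n d : nat) (alpha C L : R) : (0 < n)%N ->
  n%:R `^ (d%:R * (alpha - 1)) * (C * alpha * ln n%:R / L) ^+ d
   = (C * (alpha * n%:R `^ alpha * ln n%:R) / (n%:R * L)) ^+ d.
Proof.
move=> n0; have np : 0 < n%:R :> R by rewrite ltr0n.
rewrite [d%:R * _]mulrC powRrM powR_mulrn ?powR_ge0 // -exprMn; congr (_ ^+ _).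
rewrite powRB ?(gt_eqF np) ?implybT // powRr1 ?ler0n // invfM.
by move: (n%:R^-1) (L^-1) => a b; ring.
Qed.

Unset Implicit Arguments.

Theorem theorem1p10 (R : realType) :
  exists2 C : R, 0 < C &
    forall (alpha : R) (n : nat) (sigma : 'S_n) (chi : 'S_n -> R[i]) (d : nat),
      0 < alpha < 1 ->
      (0 < n)%N ->
      n%:R `^ (- (2 * alpha * n%:R `^ alpha)) <= class_density R sigma ->
      irreducible_char chi ->
      has_level chi d ->
      d%:R <= alpha * n%:R `^ alpha * ln n%:R ->
      ((Normc.normc (chi sigma / chi 1%g))%:E <= char_bound C alpha n d)%E.
Proof.
exists (8 * expR 4); first by rewrite mulr_gt0 ?expR_gt0.
move=> alpha n s chi d _ n0 dens [m [rG [irr chiG]]] [la [lap chiS dE]].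
set D := alpha * _ * _ => dD.
have eqtr g : \tr (specht_repr _ n la g) = \tr (rG g).
  by rewrite -[LHS]/(repr_char _ g) -chiS chiG.
have [S [f [r [g0 [cS pf f0 rE ef]]]]] := specht_pure_eigenfunction s lap irr eqtr.
have := pure_ratio_bound pf f0 rE ef; rewrite cS -dE.
rewrite -[\tr (rG s)]/(repr_char rG s) -[\tr (rG 1%g)]/(repr_char rG 1%g) -!chiG.
set z := chi s / chi 1%g => bnd.
have dn : (d <= n)%N by rewrite dE -cS -[leqRHS]card_ord max_card.
have {}bnd : Normc.normc z * 'C(n, d)%:R
    <= \sum_(A : {set 'I_n} | #|A| == d) ('C(n - d, exits s A)%:R)^-1 :> R.
  rewrite -lecR rmorphM rmorph_nat rmorph_sum /=; apply: le_trans bnd _.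
  rewrite le_eqVlt; apply/orP; left; apply/eqP.
  by apply: eq_bigr => A _; rewrite fmorphV rmorph_nat.
have z0 : 0 <= Normc.normc z by case: (z) => a b; rewrite /= sqrtr_ge0.
(* the density of a class is the inverse of the order of the centralizer *)
have cent : #|'C[s]%g|%:R <= expR (2 * D) :> R.
  have C0 : 0 < #|'C[s]%g|%:R :> R by rewrite ltr0n cardG_gt0.
  have nf : n%:R != 0 :> R by rewrite pnatr_eq0 -lt0n.
  have K0 : 0 < #|(s ^: [set: 'S_n])%g|%:R :> R.
    by rewrite ltr0n card_gt0; apply/set0Pn; exists s; apply: class_refl.
  move: dens; rewrite /class_density -(card_class_cent s) natrM invfM mulrA.
  rewrite mulfV ?gt_eqF // mul1r.
  rewrite {1}/powR (negbTE nf) mulNr expRN lef_pV2 ?posrE ?expR_gt0 //.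
  by rewrite /D -!mulrA.
rewrite /char_bound -/D; case: (posnP d) => [d0|dp].
  by rewrite d0 /= lee_fin mul0r powRr0 expr0 mulr1; apply: ratio_le1 dn bnd.
rewrite /=; case: ifPn => [_|L0]; first exact: leey.
by rewrite lee_fin scale_powR //; apply: ratio_bound bnd L0.
Qed.
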